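(* Let $R$ be a commutative algebra. Let $\psi:R\to S$ be a centralizing (respectively central) $G$-Galois extension and $\psi':R\to S'$ a centralizing (respectively central) $G'$-Galois extension, where $G$ and $G'$ are finite groups. Then the canonical extension $\psi'':R\to S\otimes_RS'$, with $G\times G'$ acting on $S\otimes_RS'$ by $(g,g')(s\otimes s')=g(s)\otimes g'(s')$, is a centralizing (respectively central) $G\times G'$-Galois extension.
   Context: Fix a commutative ring $k$; ''algebra'' means associative unital $k$-algebra. If a finite group $G$ acts by ring automorphisms on an algebra $S$, let $S(G)$ be the algebra of all maps $G\to S$ with pointwise operations, a free left $S$-module with basis the Dirac functions $\delta_g$ ($g\in G$), $\delta_g(h)=1$ if $h=g$ and $0$ otherwise. A $G$-Galois extension is a morphism of algebras $\psi:R\to S$ together with a finite group $G$ acting by ring automorphisms on $S$, trivially on $\psi(R)$, such that $S$ is faithfully flat as a left $R$-module via $\psi$ and the map $\Gamma:S\otimes_RS\to S(G)$, $\Gamma(s\otimes t)=\sum_{g\in G}s\,g(t)\,\delta_g$, is an isomorphism. The extension $\psi$ is centralizing if $\psi$ embeds $R$ in the centre of $S$ (so $R$ is commutative and $S$ is an $R$-algebra), and central if $\psi$ identifies $R$ with the centre of $S$. The algebra $S\otimes_RS'$ has multiplication $(s\otimes s')(t\otimes t')=st\otimes s't'$. *)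

(* Defs.v *)
From HB Require Import structures.
From mathcomp Require Import all_boot all_fingroup all_algebra.
From mathcomp Require Import boolp.
From mathcomp.multinomials Require Import freeg.

Set Implicit Arguments.
Unset Strict Implicit.
Unset Printing Implicit Defensive.

Import GRing.Theory.
Local Open Scope ring_scope.

(* The library's algType only covers nontrivial rings. Here an algebra over a *)
(* commutative ring k is a possibly zero ring A together with its structure   *)
(* morphism k -> Z(A); the scalar action is a x = pzin_alg a * x.             *)
HB.mixin Record PzRing_isPzAlgebra (k : comPzRingType) A of GRing.PzRing A := {
  pzin_alg : {rmorphism k -> A};
  pzin_algC : forall (a : k) (x : A), pzin_alg a * x = x * pzin_alg a
}.

#[short(type="pzAlgType")]
HB.structure Definition PzAlgebra (k : comPzRingType) :=
  {A of GRing.PzRing A & PzRing_isPzAlgebra k A}.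

#[short(type="comPzAlgType")]
HB.structure Definition ComPzAlgebra (k : comPzRingType) :=
  {A of GRing.ComPzRing A & PzAlgebra k A}.

HB.mixin Record RMorphism_isPzAlgMorphism (k : comPzRingType)
    (A B : pzAlgType k) (f : A -> B) := {
  pzalg_morphE : forall a : k, f (pzin_alg a) = pzin_alg a
}.

HB.structure Definition PzAlgMorphism (k : comPzRingType) (A B : pzAlgType k) :=
  {f of @GRing.RMorphism A B f & RMorphism_isPzAlgMorphism k A B f}.

Notation "{ 'pzalgmorphism' A -> B }" := (@PzAlgMorphism.type _ A%type B%type)
  (at level 0, A at level 98, B at level 99,
   format "{ 'pzalgmorphism'  A  ->  B }") : type_scope.

(* A right R-module is an lmodType over the converse ring R^c, so that        *)
(* [(r : R^c) *: m] is the right action m r. The tensor product M (x)_R N is  *)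
(* the free abelian group on M * N modulo the subgroup generated by the       *)
(* biadditivity and balancing relations.                                      *)
Section Tensor.
Context (R : pzRingType) (M : lmodType R^c) (N : lmodType R).

Local Notation free := {freeg (M * N)%type / int}.
Local Notation gen m n := (<<(m, n)>> : free).

Inductive tens_rel : free -> Prop :=
| tens_rel0 : tens_rel 0
| tens_relB x y : tens_rel x -> tens_rel y -> tens_rel (x - y)
| tens_relDl m1 m2 n : tens_rel (gen (m1 + m2) n - gen m1 n - gen m2 n)
| tens_relDr m n1 n2 : tens_rel (gen m (n1 + n2) - gen m n1 - gen m n2)
| tens_relZ m (r : R) n : tens_rel (gen ((r : R^c) *: m) n - gen m (r *: n)).

Definition tens_ker : {pred free} := fun x => `[< tens_rel x >].

Lemma tens_ker_zmod : zmod_closed tens_ker.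
Proof.
split; first exact/asboolP/tens_rel0.
by move=> x y /asboolP hx /asboolP hy; apply/asboolP/tens_relB.
Qed.
HB.instance Definition _ := GRing.isZmodClosed.Build free tens_ker tens_ker_zmod.

Definition tensor : Type := Quotient.quot tens_ker.
HB.instance Definition _ := GRing.Zmodule.on tensor.

Definition pure (m : M) (n : N) : tensor := \pi_(Quotient.quot tens_ker)%qT (gen m n).

(* The map x = sum m_i (x) n_i |-> sum (f m_i n_i). It is only meaningful     *)
(* (and only used) for balanced f, in which case it is the additive map       *)
(* induced by f: see [tlift_zmod] and [tlift_pure].                           *)
Definition tlift (A : zmodType) (f : M -> N -> A) (x : tensor) : A :=
  fglift (fun p : M * N => f p.1 p.2 : zmodule A) (generic_quotient.repr x).

Record balanced (A : zmodType) (f : M -> N -> A) : Prop := {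
  balancedDl : forall m1 m2 n, f (m1 + m2) n = f m1 n + f m2 n;
  balancedDr : forall m n1 n2, f m (n1 + n2) = f m n1 + f m n2;
  balancedZ : forall m (r : R) n, f ((r : R^c) *: m) n = f m (r *: n)
}.

Lemma pureDl m1 m2 n : pure (m1 + m2) n = pure m1 n + pure m2 n.
Proof.
apply/eqP; rewrite -[X in _ == X]raddfD /pure -Quotient.idealrBE opprD addrA.
exact/asboolP/tens_relDl.
Qed.

Lemma pureDr m n1 n2 : pure m (n1 + n2) = pure m n1 + pure m n2.
Proof.
apply/eqP; rewrite -[X in _ == X]raddfD /pure -Quotient.idealrBE opprD addrA.
exact/asboolP/tens_relDr.
Qed.

Lemma pureZ m (r : R) n : pure ((r : R^c) *: m) n = pure m (r *: n).
Proof. by apply/eqP; rewrite /pure -Quotient.idealrBE; exact/asboolP/tens_relZ. Qed.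

Lemma pure_balanced : balanced pure.
Proof. by split; [exact: pureDl | exact: pureDr | exact: pureZ]. Qed.

Lemma pure0l n : pure 0 n = 0.
Proof. by apply: (addrI (pure 0 n)); rewrite -pureDl !addr0. Qed.

Lemma pureNl m n : pure (- m) n = - pure m n.
Proof. by apply/eqP; rewrite -addr_eq0 -pureDl addNr pure0l. Qed.

Lemma tensor_ind (P : tensor -> Prop) :
  (forall m n, P (pure m n)) -> (forall x y, P x -> P y -> P (x + y)) ->
  forall x, P x.
Proof.
move=> Pp PD x; have P0 : P 0 by rewrite -(pure0l 0).
rewrite -[x]reprK -[generic_quotient.repr x]freeg_sumE raddf_sum.
elim/big_rec: _ => [|[m n] y _ Py]; first exact: P0.
apply: (PD _ _ _ Py); rewrite -[coeff _ _]intz -freegU_mulz raddfMz -/(pure m n).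
have Pn j m' : P (pure m' n *+ j).
  by elim: j => [|j IHj]; rewrite ?mulr0n // mulrS; exact: PD.
case: (coeff _ _) => j; first exact: Pn.
by rewrite NegzE mulrNz -mulNrz -pureNl; exact: Pn.
Qed.

Section Lift.
Context (A : zmodType) (f : M -> N -> A) (fB : balanced f).

Let F : {freeg (M * N)%type / int} -> A :=
  fglift (fun p : M * N => f p.1 p.2 : zmodule A).

Let FB x y : F (x - y) = F x - F y.
Proof. exact: (lift_is_additive (fun p : M * N => f p.1 p.2 : zmodule A)). Qed.

Let Fgen m n : F (gen m n) = f m n.
Proof. exact: (liftU (fun p : M * N => f p.1 p.2 : zmodule A)). Qed.

Let Fker x : x \in tens_ker -> F x = 0.
Proof.
move=> /asboolP; elim=> {x}.
- by rewrite -[0](subrr 0) FB subrr.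
- by move=> x y _ Fx _ Fy; rewrite FB Fx Fy subrr.
- by move=> m1 m2 n; rewrite !FB !Fgen balancedDl // addrAC addrK subrr.
- by move=> m n1 n2; rewrite !FB !Fgen balancedDr // addrAC addrK subrr.
- by move=> m r n; rewrite FB !Fgen balancedZ // subrr.
Qed.

Let liftE x : tlift f (\pi_(Quotient.quot tens_ker)%qT x) = F x.
Proof.
apply/eqP; rewrite -subr_eq0 -[tlift _ _]/(F _) -FB Fker //.
by rewrite Quotient.idealrBE reprK.
Qed.

Lemma tlift_pure m n : tlift f (pure m n) = f m n.
Proof. by rewrite liftE Fgen. Qed.

Lemma tlift_zmod : zmod_morphism (tlift f).
Proof.
move=> x y; rewrite -[x]reprK -[y]reprK.
have -> : (\pi_(Quotient.quot tens_ker) (generic_quotient.repr x) -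
  \pi_(Quotient.quot tens_ker) (generic_quotient.repr y) =
  \pi_(Quotient.quot tens_ker) (generic_quotient.repr x - generic_quotient.repr y))%qT.
  by rewrite raddfB.
by rewrite !liftE FB.
Qed.

Lemma tliftD : {morph tlift f : x y / x + y}.
Proof.
move=> x y; have tl0 : tlift f 0 = 0 by rewrite -(subrr (0 : tensor)) tlift_zmod subrr.
have tlN : tlift f (- y) = - tlift f y by rewrite -[- y]sub0r tlift_zmod tl0 sub0r.
by rewrite -{1}[y]opprK tlift_zmod tlN opprK.
Qed.

End Lift.

End Tensor.

Definition tensor_map (R : pzRingType) (M1 M2 : lmodType R^c) (N : lmodType R)
    (f : {linear M1 -> M2}) : tensor M1 N -> tensor M2 N :=
  tlift (fun m n => pure (f m) n).
Arguments tensor_map {R M1 M2} N f.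

Definition exact_at (U V W : zmodType) (f : U -> V) (g : V -> W) : Prop :=
  forall v, g v = 0 <-> exists u, f u = v.

(* - (x)_R N preserves and reflects exactness of sequences of right modules.  *)
Definition faithfully_flat (R : pzRingType) (N : lmodType R) : Prop :=
  forall (M1 M2 M3 : lmodType R^c) (f : {linear M1 -> M2}) (g : {linear M2 -> M3}),
    exact_at f g <-> exact_at (tensor_map N f) (tensor_map N g).

(* S as a left, resp. right, R-module by restriction of scalars along psi.    *)
Definition lrestr (R S : pzRingType) (psi : {rmorphism R -> S}) : Type := S.
Definition rrestr (R S : pzRingType) (psi : {rmorphism R -> S}) : Type := S.

Section Restriction.
Context (R S : pzRingType) (psi : {rmorphism R -> S}).

Let lscale (r : R) (s : S) : S := psi r * s.
Fact lscaleA a b s : lscale a (lscale b s) = lscale (a * b) s.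
Proof. by rewrite /lscale rmorphM mulrA. Qed.
Fact lscale1 : left_id 1 lscale.
Proof. by move=> s; rewrite /lscale rmorph1 mul1r. Qed.
Fact lscaleDr : right_distributive lscale +%R.
Proof. by move=> a s t; rewrite /lscale mulrDr. Qed.
Fact lscaleDl s : {morph lscale^~ s : a b / a + b}.
Proof. by move=> a b; rewrite /lscale rmorphD mulrDl. Qed.

HB.instance Definition _ := GRing.Zmodule.copy (lrestr psi) S.
HB.instance Definition _ := GRing.Zmodule_isLmodule.Build R (lrestr psi)
  lscaleA lscale1 lscaleDr lscaleDl.

Let rscale (r : R^c) (s : S) : S := s * psi r.
Fact rscaleA a b s : rscale a (rscale b s) = rscale (a * b) s.
Proof. by rewrite /rscale (rmorphM psi) mulrA. Qed.
Fact rscale1 : left_id 1 rscale.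
Proof. by move=> s; rewrite /rscale (rmorph1 psi) mulr1. Qed.
Fact rscaleDr : right_distributive rscale +%R.
Proof. by move=> a s t; rewrite /rscale mulrDl. Qed.
Fact rscaleDl s : {morph rscale^~ s : a b / a + b}.
Proof. by move=> a b; rewrite /rscale (rmorphD psi) mulrDr. Qed.

HB.instance Definition _ := GRing.Zmodule.copy (rrestr psi) S.
HB.instance Definition _ := GRing.Zmodule_isLmodule.Build R^c (rrestr psi)
  rscaleA rscale1 rscaleDr rscaleDl.

Lemma lrestrE (r : R) (s : S) : r *: (s : lrestr psi) = psi r * s.
Proof. by []. Qed.

Lemma rrestrE (r : R) (s : S) : (r : R^c) *: (s : rrestr psi) = s * psi r.
Proof. by []. Qed.

End Restriction.

(* S (x)_R S' for ring morphisms psi : R -> S and psi' : R -> S'.             *)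
Notation "psi ⊗ psi'" := (tensor (rrestr psi) (lrestr psi'))
  (at level 40, left associativity, format "psi  ⊗  psi'") : type_scope.

Definition ptens (R S S' : pzRingType) (psi : {rmorphism R -> S})
    (psi' : {rmorphism R -> S'}) (s : S) (s' : S') : (psi ⊗ psi')%type :=
  @pure R (rrestr psi) (lrestr psi') s s'.

Record is_ring_action (gT : finGroupType) (S : pzRingType)
    (act : gT -> S -> S) : Prop := {
  ring_act_zmod : forall g, zmod_morphism (act g);
  ring_act_monoid : forall g, monoid_morphism (act g);
  ring_act1 : forall s, act 1%g s = s;
  ring_actM : forall g h s, act (g * h)%g s = act g (act h s)
}.

Lemma ring_actD (gT : finGroupType) (S : pzRingType) (act : gT -> S -> S) :
  is_ring_action act -> forall g, {morph act g : x y / x + y}.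
Proof.
move=> ha g x y; have aB := ring_act_zmod ha g.
have a0 : act g 0 = 0 by rewrite -{1}(subrr 0) aB subrr.
have aN : act g (- y) = - act g y by rewrite -[- y]sub0r aB a0 sub0r.
by rewrite -{1}[y]opprK aB aN opprK.
Qed.

(* S(G) is {ffun gT -> S^o}, a left S-module for the pointwise operations.    *)
Definition dirac (gT : finGroupType) (S : pzRingType) (g : gT) :
    {ffun gT -> S^o} := [ffun h => if h == g then 1 else 0].

Definition galois_map (R S : pzRingType) (psi : {rmorphism R -> S})
    (gT : finGroupType) (act : gT -> S -> S) :
    (psi ⊗ psi)%type -> {ffun gT -> S^o} :=
  @tlift R (rrestr psi) (lrestr psi) {ffun gT -> S^o}
    (fun s t : S => \sum_(g : gT) (s * act g t) *: dirac S g).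
Arguments galois_map {R S} psi {gT} act.

(* The group G is the whole type gT. The map Gamma is additive and left       *)
(* S-linear, so it is an isomorphism as soon as it is bijective.              *)
Record galois_extension (k : comPzRingType) (R S : pzAlgType k)
    (psi : {pzalgmorphism R -> S}) (gT : finGroupType)
    (act : gT -> S -> S) : Prop := {
  galois_action : is_ring_action act;
  galois_fix : forall g r, act g (psi r) = psi r;
  galois_flat : faithfully_flat (lrestr psi);
  galois_bij : bijective (galois_map psi act)
}.

Record centralizing (R S : pzRingType) (psi : {rmorphism R -> S}) : Prop := {
  centralizing_inj : injective psi;
  centralizingC : forall r s, psi r * s = s * psi r
}.

Record central (R S : pzRingType) (psi : {rmorphism R -> S}) : Prop := {
  central_inj : injective psi;
  central_range : forall z, (forall s, z * s = s * z) <-> exists r, psi r = z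
}.

Lemma central_centralizing (R S : pzRingType) (psi : {rmorphism R -> S}) :
  central psi -> centralizing psi.
Proof.
case=> inj rg; split=> // r s.
by have [_ ->] := rg (psi r); last by exists r.
Qed.

(* For centralizing psi and psi', S (x)_R S' is an algebra for the product    *)
(* (s (x) s') (t (x) t') = s t (x) s' t' (see [tens_mulE]).                   *)
Section TensorRing.
Context (R S S' : pzRingType) (psi : {rmorphism R -> S})
  (psi' : {rmorphism R -> S'}).
Hypotheses (c : centralizing psi) (c' : centralizing psi').

Local Notation T := (psi ⊗ psi')%type.
Local Notation "s # s'" := (ptens psi psi' s s') (at level 30).

Lemma ptensDl s1 s2 s' : (s1 + s2) # s' = s1 # s' + s2 # s'.
Proof. exact: pureDl. Qed.

Lemma ptensDr s s1' s2' : s # (s1' + s2') = s # s1' + s # s2'.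
Proof. exact: pureDr. Qed.

Lemma ptensZ s r s' : (s * psi r) # s' = s # (psi' r * s').
Proof. exact: (@pureZ R (rrestr psi) (lrestr psi') s r s'). Qed.

Lemma ptens_ind (P : T -> Prop) :
  (forall s s', P (s # s')) -> (forall x y, P x -> P y -> P (x + y)) ->
  forall x, P x.
Proof. exact: (@tensor_ind R (rrestr psi) (lrestr psi') P). Qed.

Let lmulf (s : S) (s' : S') : rrestr psi -> lrestr psi' -> T :=
  fun t t' => (s * t) # (s' * t').

Let lmulf_balanced s s' : balanced (lmulf s s').
Proof.
split=> [t1 t2 t'|t t1' t2'|t r t']; rewrite /lmulf.
- by rewrite mulrDr ptensDl.
- by rewrite mulrDr ptensDr.
- by rewrite rrestrE lrestrE mulrA ptensZ mulrA (centralizingC c') mulrA.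
Qed.

Let lmul s s' : T -> T := tlift (lmulf s s').

Let lmulE s s' t t' : lmul s s' (t # t') = (s * t) # (s' * t').
Proof. exact: tlift_pure (lmulf_balanced s s') t t'. Qed.

Let lmulD s s' : {morph lmul s s' : x y / x + y}.
Proof. exact: tliftD (lmulf_balanced s s'). Qed.

Definition tens_mul (x y : T) : T :=
  @tlift R (rrestr psi) (lrestr psi') T
    (fun s s' => @tlift R (rrestr psi) (lrestr psi') T
      (fun t t' => (s * t) # (s' * t')) y) x.

Let tens_mul_balanced y :
  @balanced R (rrestr psi) (lrestr psi') T (fun s s' => lmul s s' y).
Proof.
elim/ptens_ind: y => [t t'|y1 y2 [h1 h2 h3] [k1 k2 k3]]; split=> *.
- by rewrite !lmulE mulrDl ptensDl.
- by rewrite !lmulE mulrDl ptensDr.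
- rewrite !lmulE rrestrE lrestrE -mulrA (centralizingC c) mulrA ptensZ.
  by rewrite mulrA.
- by rewrite !lmulD h1 k1 addrACA.
- by rewrite !lmulD h2 k2 addrACA.
- by rewrite !lmulD h3 k3.
Qed.

Lemma tens_mulE s s' t t' : tens_mul (s # s') (t # t') = (s * t) # (s' * t').
Proof. by rewrite -lmulE; exact: tlift_pure (tens_mul_balanced _) s s'. Qed.

Fact tens_mulDl : left_distributive tens_mul +%R.
Proof. by move=> x1 x2 y; exact: tliftD (tens_mul_balanced y) x1 x2. Qed.

Fact tens_mulDr : right_distributive tens_mul +%R.
Proof.
move=> x y1 y2; elim/ptens_ind: x => [s s'|x1 x2 h1 h2].
  rewrite /tens_mul !(tlift_pure (tens_mul_balanced _)); exact: lmulD.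
by rewrite !tens_mulDl h1 h2 addrACA.
Qed.

Fact tens_mulA : associative tens_mul.
Proof.
move=> x y z; elim/ptens_ind: x => [s s'|x1 x2 h1 h2]; last first.
  by rewrite !tens_mulDl h1 h2.
elim/ptens_ind: y => [t t'|y1 y2 h1 h2]; last first.
  by rewrite !(tens_mulDl, tens_mulDr) h1 h2.
elim/ptens_ind: z => [u u'|z1 z2 h1 h2]; last first.
  by rewrite !tens_mulDr h1 h2.
by rewrite !tens_mulE !mulrA.
Qed.

Fact tens_mul1l : left_id (1 # 1) tens_mul.
Proof.
elim/ptens_ind=> [s s'|x y hx hy]; first by rewrite tens_mulE !mul1r.
by rewrite tens_mulDr hx hy.
Qed.

Fact tens_mul1r : right_id (1 # 1) tens_mul.
Proof.
elim/ptens_ind=> [s s'|x y hx hy]; first by rewrite tens_mulE !mulr1.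
by rewrite tens_mulDl hx hy.
Qed.

Definition tens_ring (_ : centralizing psi) (_ : centralizing psi') : Type := T.

Local Notation TR := (tens_ring c c').

HB.instance Definition _ := GRing.Zmodule.copy TR T.
HB.instance Definition _ := GRing.Zmodule_isPzRing.Build TR
  tens_mulA tens_mul1l tens_mul1r tens_mulDl tens_mulDr.

Definition tens_unit (r : R) : TR := psi r # 1.

Fact tens_unit_zmod : zmod_morphism tens_unit.
Proof.
move=> x y; apply: (addIr (psi y # 1)).
by rewrite -[LHS]ptensDl rmorphB !subrK.
Qed.

Fact tens_unit_monoid : monoid_morphism tens_unit.
Proof.
split=> [|x y]; first by rewrite /tens_unit rmorph1.
by rewrite /tens_unit [RHS]tens_mulE rmorphM mulr1.
Qed.

HB.instance Definition _ := GRing.isZmodMorphism.Build R TR tens_unit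
  tens_unit_zmod.
HB.instance Definition _ := GRing.isMonoidMorphism.Build R TR tens_unit
  tens_unit_monoid.

Lemma tens_unitC (r : R) (x : TR) : tens_unit r * x = x * tens_unit r.
Proof.
elim/ptens_ind: x => [s s'|x y hx hy].
  rewrite [LHS]tens_mulE [RHS]tens_mulE mul1r mulr1.
  by rewrite (centralizingC c).
by rewrite [LHS]tens_mulDr [RHS]tens_mulDl; congr (_ + _).
Qed.

End TensorRing.
Arguments tens_unit {R S S' psi psi'} c c' r.

Section TensorAlgebra.
Context (k : comPzRingType) (R S S' : pzAlgType k)
  (psi : {pzalgmorphism R -> S}) (psi' : {pzalgmorphism R -> S'}).
Hypotheses (c : centralizing psi) (c' : centralizing psi').

Local Notation TR := (tens_ring c c').

Definition tens_in_alg : {rmorphism k -> TR} :=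
  (tens_unit c c' \o (pzin_alg : k -> R))%FUN.

Fact tens_in_algC (a : k) (x : TR) : tens_in_alg a * x = x * tens_in_alg a.
Proof. exact: tens_unitC. Qed.

HB.instance Definition _ := PzRing_isPzAlgebra.Build k TR tens_in_algC.

Fact tens_unit_alg (a : k) : tens_unit c c' (pzin_alg a) = pzin_alg a.
Proof. by []. Qed.

HB.instance Definition _ := RMorphism_isPzAlgMorphism.Build k R TR
  (tens_unit c c') tens_unit_alg.

End TensorAlgebra.

(* (g, g') (s (x) s') = g s (x) g' s', see [tens_actE]; as for [tlift], this  *)
(* is only meaningful when the actions are R-linear.                          *)
Definition tens_act (R S S' : pzRingType) (psi : {rmorphism R -> S})
    (psi' : {rmorphism R -> S'}) (c : centralizing psi) (c' : centralizing psi')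
    (gT gT' : finGroupType) (act : gT -> S -> S) (act' : gT' -> S' -> S')
    (g : gT * gT') : tens_ring c c' -> tens_ring c c' :=
  @tlift R (rrestr psi) (lrestr psi') (psi ⊗ psi')%type
    (fun s s' => ptens psi psi' (act g.1 s) (act' g.2 s')).
Arguments tens_act {R S S' psi psi'} c c' {gT gT'} act act' g.

Lemma tens_actE (R S S' : pzRingType) (psi : {rmorphism R -> S})
    (psi' : {rmorphism R -> S'}) (c : centralizing psi) (c' : centralizing psi')
    (gT gT' : finGroupType) (act : gT -> S -> S) (act' : gT' -> S' -> S') :
  is_ring_action act -> is_ring_action act' ->
  (forall g r, act g (psi r) = psi r) ->
  (forall g r, act' g (psi' r) = psi' r) ->
  forall g g' s s', tens_act c c' act act' (g, g') (ptens psi psi' s s') =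
    ptens psi psi' (act g s) (act' g' s').
Proof.
move=> ha ha' fa fa' g g' s s'.
have D := ring_actD ha; have D' := ring_actD ha'.
have M h := (ring_act_monoid ha h).2; have M' h := (ring_act_monoid ha' h).2.
apply: (@tlift_pure R (rrestr psi) (lrestr psi')); split=> /= [s1 s2 t|u t1 t2|u r t].
- by rewrite D ptensDl.
- by rewrite D' ptensDr.
- by rewrite rrestrE lrestrE M M' fa fa' ptensZ.
Qed.

Lemma galois_mapE (R S : pzRingType) (psi : {rmorphism R -> S})
    (gT : finGroupType) (act : gT -> S -> S) :
  is_ring_action act -> (forall g r, act g (psi r) = psi r) ->
  forall s t, galois_map psi act (ptens psi psi s t) =
    \sum_(g : gT) (s * act g t) *: dirac S g.
Proof.
move=> ha fa s t; have D := ring_actD ha.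
have M h := (ring_act_monoid ha h).2.
apply: (@tlift_pure R (rrestr psi) (lrestr psi)); split=> /= [s1 s2 u|u t1 t2|u r v].
- by rewrite -big_split; apply: eq_bigr => g _; rewrite mulrDl scalerDl.
- by rewrite -big_split; apply: eq_bigr => g _; rewrite D mulrDr scalerDl.
- by apply: eq_bigr => g _; rewrite rrestrE lrestrE M fa mulrA.
Qed.

(* Main.v *)
Require Import Defs.
From HB Require Import structures.
From mathcomp Require Import all_boot all_fingroup all_algebra.

Set Implicit Arguments.
Unset Strict Implicit.
Unset Printing Implicit Defensive.

Import GRing.Theory.
Local Open Scope ring_scope.

(** Write T for S (x)_R S'. Apart from the action, which is checked on pure
    tensors, there are four things to see.

    Flatness: since R is commutative and central in S, M (x)_R S is again a
    right R-module and M (x)_R T is naturally (M (x)_R S) (x)_R S'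
    ([tensor_assoc]), so tensoring with T is the composite of two functors that
    preserve and reflect exactness ([faithfully_flat_tens]).

    The Galois map: exchanging the two middle factors gives a pairing [mix] of
    S (x) S and S' (x) S' into T (x) T, under which the Galois map of T is the
    tensor product of those of S and S' ([galois_map_mix]). Its inverse sends
    (s (x) s') delta_(g, g') to the mix of the preimages of s delta_g and
    s' delta_g' ([galois_map_tens_bij]).

    Injectivity of R -> T: psi is injective and S' is flat, so s' |-> 1 (x) s'
    is injective ([ptens1_inj]).

    The centre: let psi be central. Faithfully flat descent (exactness of the
    start of the Amitsur complex, [amitsur_exact]) shows that the G-invariants
    of S are the elements of R, so that traces lie in R. If
    e = sum_i x_i (x) y_i is the preimage of delta_1, then
    s = sum_i x_i tr(y_i s) for all s: the x_i generate S over R, and z in S is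
    central as soon as it commutes with them. The map
    z |-> sum_i [z, x_i] (x) y_i encodes these commutators in one R-linear map
    S -> S (x) S, whose kernel is therefore R ([commutator_exact]). Tensored
    with the flat module S', this says that an element of T that commutes with
    S (x) 1 has the form 1 (x) s'; if it is central, then s' is central in S',
    hence lies in R ([central_tens]). *)

(** * Additive maps and tensor products *)

Lemma morphD0 (U V : zmodType) (f : U -> V) :
  {morph f : x y / x + y} -> f 0 = 0.
Proof. by move=> fD; apply: (addrI (f 0)); rewrite -fD !addr0. Qed.

Lemma morphD_zmod (U V : zmodType) (f : U -> V) :
  {morph f : x y / x + y} -> zmod_morphism f.
Proof. by move=> fD x y; apply: (addIr (f y)); rewrite -fD !subrK. Qed.

Lemma morphD_sum (U V : zmodType) (f : U -> V) (I : finType) (F : I -> U) :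
  {morph f : x y / x + y} -> f (\sum_i F i) = \sum_i f (F i).
Proof. by move=> fD; rewrite (big_morph f fD (morphD0 fD)). Qed.

Lemma pure0r (R : pzRingType) (M : lmodType R^c) (N : lmodType R) (m : M) :
  pure m (0 : N) = 0.
Proof. exact: morphD0 (pureDr m). Qed.

Section TensorMap.
Context (R : pzRingType) (M1 M2 : lmodType R^c) (N : lmodType R).
Context (f : {linear M1 -> M2}).

Lemma tensor_map_balanced : balanced (fun m (n : N) => pure (f m) n).
Proof.
split=> [m1 m2 n|m n1 n2|m r n]; first by rewrite linearD pureDl.
  by rewrite pureDr.
by rewrite linearZ pureZ.
Qed.

Lemma tensor_mapE m n : tensor_map N f (pure m n) = pure (f m) n.
Proof. exact: tlift_pure tensor_map_balanced m n. Qed.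

Lemma tensor_mapD : {morph tensor_map N f : x y / x + y}.
Proof. exact: tliftD tensor_map_balanced. Qed.

End TensorMap.

Lemma tensor_map0 (R : pzRingType) (M1 M2 : lmodType R^c) (N : lmodType R) x :
  tensor_map N (\0 : {linear M1 -> M2}) x = 0.
Proof.
elim/tensor_ind: x => [m n|x y hx hy]; first by rewrite tensor_mapE pure0l.
by rewrite tensor_mapD hx hy addr0.
Qed.

(** * Tensor products over a commutative ring as modules *)

Section TensorModule.
Context (R : comPzRingType) (M : lmodType R^c) (N : lmodType R).

Definition tensor_scale (r : R^c) (x : tensor M N) : tensor M N :=
  tlift (fun m n => pure (r *: m) n) x.

(** Commutativity of R is what makes the scaling of the left factor balanced. *)
Lemma tensor_scale_balanced (r : R^c) :
  balanced (fun (m : M) (n : N) => pure (r *: m) n).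
Proof.
split=> [m1 m2 n|m n1 n2|m r' n]; first by rewrite scalerDr pureDl.
  by rewrite pureDr.
by rewrite -pureZ !scalerA; congr (pure (_ *: _) _); exact: (@mulrC R).
Qed.

Lemma tensor_scaleE r m n : tensor_scale r (pure m n) = pure (r *: m) n.
Proof. exact: tlift_pure (tensor_scale_balanced r) m n. Qed.

Lemma tensor_scaleDr : right_distributive tensor_scale +%R.
Proof. move=> r; exact: tliftD (tensor_scale_balanced r). Qed.

Lemma tensor_scaleDl x : {morph tensor_scale^~ x : a b / a + b}.
Proof.
move=> a b; elim/tensor_ind: x => [m n|x y hx hy].
  by rewrite !tensor_scaleE scalerDl pureDl.
by rewrite !tensor_scaleDr hx hy addrACA.
Qed.

Lemma tensor_scaleA a b x :
  tensor_scale a (tensor_scale b x) = tensor_scale (a * b) x.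
Proof.
elim/tensor_ind: x => [m n|x y hx hy]; last by rewrite !tensor_scaleDr hx hy.
by rewrite !tensor_scaleE scalerA.
Qed.

Lemma tensor_scale1 : left_id 1 tensor_scale.
Proof.
elim/tensor_ind => [m n|x y hx hy]; last by rewrite !tensor_scaleDr hx hy.
by rewrite !tensor_scaleE scale1r.
Qed.

HB.instance Definition _ := GRing.Zmodule_isLmodule.Build R^c (tensor M N)
  tensor_scaleA tensor_scale1 tensor_scaleDr tensor_scaleDl.

Lemma scale_pure (r : R^c) m n : r *: (pure m n : tensor M N) = pure (r *: m) n.
Proof. exact: tensor_scaleE. Qed.

Lemma scale_purer (r : R) m n :
  (r : R^c) *: (pure m n : tensor M N) = pure m (r *: n).
Proof. by rewrite scale_pure pureZ. Qed.
End TensorModule.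

Section TensorMapLinear.
Context (R : comPzRingType) (M1 M2 : lmodType R^c) (N : lmodType R).
Context (f : {linear M1 -> M2}).

Fact tensor_map_scalable : scalable (tensor_map N f).
Proof.
move=> r x; elim/tensor_ind: x => [m n|x y hx hy].
  by rewrite scale_pure !tensor_mapE scale_pure linearZ.
by rewrite scalerDr !tensor_mapD scalerDr hx hy.
Qed.

HB.instance Definition _ := GRing.isZmodMorphism.Build _ _ (tensor_map N f)
  (morphD_zmod (@tensor_mapD _ _ _ N f)).
HB.instance Definition _ := GRing.isScalable.Build R^c _ _ _ (tensor_map N f)
  tensor_map_scalable.
End TensorMapLinear.

(** * Exactness *)

Lemma exact_at_iso (U V W U' V' W' : zmodType) (f : U -> V) (g : V -> W)
    (f' : U' -> V') (g' : V' -> W') (a : U -> U') (b : V -> V') (c : W -> W') :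
  bijective a -> bijective b -> bijective c -> c 0 = 0 ->
  (forall u, b (f u) = f' (a u)) -> (forall v, c (g v) = g' (b v)) ->
  exact_at f g <-> exact_at f' g'.
Proof.
move=> [a' aK a'K] [b' bK b'K] [c' cK c'K] c0 bf cg; split=> ex v.
  rewrite -[v]b'K -cg -{1}c0; split=> [/(can_inj cK)/ex[u <-]|[u' E]].
    by exists (a u); rewrite bf.
  congr c; apply/ex; exists (a' u').
  by apply: (can_inj bK); rewrite bf a'K.
split=> [gv0|[u E]].
  have /ex [u' E] : g' (b v) = 0 by rewrite -cg gv0.
  by exists (a' u'); apply: (can_inj bK); rewrite bf a'K.
apply: (can_inj cK); rewrite cg c0; apply/ex; exists (a u); by rewrite -bf E.
Qed.

(** Injectivity of f is exactness of M1 -> M1 -> M2 whose first map is zero. *)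
Lemma faithfully_flat_inj (R : pzRingType) (M1 M2 : lmodType R^c)
    (N : lmodType R) (f : {linear M1 -> M2}) :
  faithfully_flat N -> injective f -> forall x, tensor_map N f x = 0 -> x = 0.
Proof.
move=> ff fI x fx0.
have /ff ex : exact_at (\0 : {linear M1 -> M1}) f.
  move=> v; split=> [fv0|[u <-]]; last by rewrite linear0.
  by exists 0; apply: fI; rewrite fv0 linear0.
by have [/(_ fx0)[u <-] _] := ex x; rewrite tensor_map0.
Qed.


Lemma tens_ring_mulE (R S S' : pzRingType) (psi : {rmorphism R -> S})
    (psi' : {rmorphism R -> S'}) (c : centralizing psi) (c' : centralizing psi')
    s s' t t' :
  (ptens psi psi' s s' : tens_ring c c') *
    (ptens psi psi' t t' : tens_ring c c') =
    ptens psi psi' (s * t) (s' * t').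
Proof. exact: tens_mulE. Qed.

(** * Associativity, and faithful flatness of S (x) S' *)

Section Assoc.
Context (R : comPzRingType) (S S' : pzRingType) (psi : {rmorphism R -> S})
  (psi' : {rmorphism R -> S'}).
Hypotheses (c : centralizing psi) (c' : centralizing psi').

Local Notation N := (lrestr psi).
Local Notation N' := (lrestr psi').
Local Notation NT := (lrestr (tens_unit c c')).

Lemma tens_unit_mul r s s' :
  tens_unit c c' r * (ptens psi psi' s s' : tens_ring c c') =
    ptens psi psi' (psi r * s) s'.
Proof. by rewrite tens_ring_mulE mul1r. Qed.

(** Together with [tens_unit_mul]: R acts on S (x) S' through either factor,
    which is how balancedness conditions over R are verified below. *)
Lemma tens_unit_mulr r s s' :
  tens_unit c c' r * (ptens psi psi' s s' : tens_ring c c') =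
    ptens psi psi' s (psi' r * s').
Proof. by rewrite tens_unit_mul (centralizingC c) ptensZ. Qed.

Lemma tens_scaleE r (x : (psi ⊗ psi')%type) :
  (r : R^c) *: x = tens_unit c c' r * (x : tens_ring c c').
Proof.
elim/ptens_ind: x => [s s'|x y hx hy]; last first.
  by rewrite scalerDr hx hy; exact: esym (tens_mulDr c c' _ _ _).
by rewrite scale_pure [RHS]tens_unit_mul rrestrE (centralizingC c).
Qed.

Section Maps.
Context (M : lmodType R^c).

Definition assoc_inner (s' : S') (x : tensor M N) : tensor M NT :=
  tlift (fun (m : M) (s : N) => pure m (ptens psi psi' s s' : NT)) x.

Lemma assoc_inner_balanced s' :
  balanced (fun (m : M) (s : N) => pure m (ptens psi psi' s s' : NT)).
Proof.
split=> [m1 m2 s|m s1 s2|m r s]; first by rewrite pureDl.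
  by rewrite ptensDl pureDr.
by rewrite pureZ lrestrE; congr pure; rewrite lrestrE tens_unit_mul.
Qed.

Lemma assoc_innerE s' m s :
  assoc_inner s' (pure m s) = pure m (ptens psi psi' s s' : NT).
Proof. exact: tlift_pure (assoc_inner_balanced s') m s. Qed.

Lemma assoc_innerD s' : {morph assoc_inner s' : x y / x + y}.
Proof. exact: tliftD (assoc_inner_balanced s'). Qed.

Lemma assoc_balanced :
  balanced (fun (x : tensor M N) (s' : N') => assoc_inner s' x).
Proof.
split=> [x y s'|x s1 s2|x r s']; first exact: assoc_innerD.
  elim/tensor_ind: x => [m s|x y hx hy].
    by rewrite !assoc_innerE ptensDr pureDr.
  by rewrite !assoc_innerD hx hy addrACA.
elim/tensor_ind: x => [m s|x y hx hy].
  rewrite scale_purer !assoc_innerE; congr pure.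
  by rewrite !lrestrE -tens_unit_mul tens_unit_mulr.
by rewrite scalerDr !assoc_innerD hx hy.
Qed.

Definition tensor_assoc : tensor (tensor M N) N' -> tensor M NT :=
  tlift (fun (x : tensor M N) (s' : N') => assoc_inner s' x).

Lemma tensor_assocE m s s' :
  tensor_assoc (pure (pure m s) s') = pure m (ptens psi psi' s s' : NT).
Proof. by rewrite /tensor_assoc (tlift_pure assoc_balanced) assoc_innerE. Qed.

Lemma tensor_assocD : {morph tensor_assoc : x y / x + y}.
Proof. exact: tliftD assoc_balanced. Qed.

(** The inverse of the associativity map, at a fixed m in M. *)
Definition unassoc_inner (m : M) (t : NT) : tensor (tensor M N) N' :=
  @tlift R (rrestr psi) (lrestr psi') _
    (fun (s : S) (s' : S') => pure (pure m (s : N)) (s' : N')) t.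

Lemma unassoc_inner_balanced m : @balanced R (rrestr psi) (lrestr psi')
    (tensor (tensor M N) N')
    (fun (s : S) (s' : S') => pure (pure m (s : N)) (s' : N')).
Proof.
split=> [s1 s2 s'|s s1 s2|s r s']; first by rewrite !pureDr pureDl.
  by rewrite pureDr.
by rewrite -pureZ scale_purer rrestrE lrestrE (centralizingC c).
Qed.

Lemma unassoc_innerE m s s' :
  unassoc_inner m (ptens psi psi' s s') = pure (pure m (s : N)) (s' : N').
Proof. exact: tlift_pure (unassoc_inner_balanced m) s s'. Qed.

Lemma unassoc_innerD m : {morph unassoc_inner m : x y / x + y}.
Proof. exact: tliftD (unassoc_inner_balanced m). Qed.

Lemma unassoc_balanced : balanced unassoc_inner.
Proof.
split=> [m1 m2 t|m t1 t2|m r t].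
- elim/ptens_ind: t => [s s'|x y hx hy]; last first.
    by rewrite !unassoc_innerD hx hy addrACA.
  by rewrite !unassoc_innerE !pureDl.
- exact: unassoc_innerD.
- elim/ptens_ind: t => [s s'|x y hx hy]; last first.
    by rewrite scalerDr !unassoc_innerD hx hy.
  by rewrite unassoc_innerE lrestrE tens_unit_mul unassoc_innerE pureZ.
Qed.

Lemma tensor_assoc_bij : bijective tensor_assoc.
Proof.
pose h (x : tensor M NT) := tlift unassoc_inner x.
have hD : {morph h : x y / x + y} by exact: tliftD unassoc_balanced.
have hE m t : h (pure m t) = unassoc_inner m t.
  exact: tlift_pure unassoc_balanced m t.
exists h.
  elim/tensor_ind=> [x s'|x y hx hy]; last by rewrite tensor_assocD hD hx hy.
  elim/tensor_ind: x => [m s|x y hx hy]; last first.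
    by rewrite pureDl tensor_assocD hD hx hy.
  by rewrite tensor_assocE hE unassoc_innerE.
elim/tensor_ind=> [m t|x y hx hy]; last by rewrite hD tensor_assocD hx hy.
elim/ptens_ind: t => [s s'|x y hx hy].
  by rewrite hE unassoc_innerE tensor_assocE.
by rewrite [pure _ _]pureDr hD tensor_assocD hx hy.
Qed.

End Maps.

Lemma tensor_assoc_natural (M1 M2 : lmodType R^c) (f : {linear M1 -> M2}) x :
  tensor_assoc (tensor_map N' (tensor_map N f) x) =
    tensor_map NT f (tensor_assoc x).
Proof.
elim/tensor_ind: x => [x s'|x y hx hy]; last first.
  by rewrite !tensor_mapD !tensor_assocD tensor_mapD hx hy.
elim/tensor_ind: x => [m s|x y hx hy]; last first.
  by rewrite pureDl !tensor_mapD !tensor_assocD tensor_mapD hx hy.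
by rewrite !tensor_mapE tensor_assocE /= tensor_mapE tensor_assocE tensor_mapE.
Qed.

Lemma faithfully_flat_tens :
  faithfully_flat N -> faithfully_flat N' -> faithfully_flat NT.
Proof.
move=> ff ff' M1 M2 M3 f g.
apply: (iff_trans (ff _ _ _ f g)).
apply: (iff_trans (ff' _ _ _ (tensor_map N f) (tensor_map N g))).
apply: exact_at_iso (tensor_assoc_bij M1) (tensor_assoc_bij M2)
  (tensor_assoc_bij M3) _ _ _.
- exact: morphD0 (@tensor_assocD M3).
- exact: tensor_assoc_natural.
- exact: tensor_assoc_natural.
Qed.

End Assoc.

(** * The Galois map *)

Section GaloisMap.
Context (R S : pzRingType) (psi : {rmorphism R -> S}) (gT : finGroupType)
  (act : gT -> S -> S).
Hypotheses (ha : is_ring_action act) (fa : forall g r, act g (psi r) = psi r).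

Lemma scale_diracE (s : S) (g h : gT) :
  ((s : S) *: dirac S g) h = if h == g then s else 0.
Proof.
rewrite !ffunE; case: eqP => _; [exact: mulr1 | exact: mulr0].
Qed.

Lemma dirac_sum (F : {ffun gT -> S^o}) : \sum_g (F g : S) *: dirac S g = F.
Proof.
apply/ffunP => h; rewrite sum_ffunE (bigD1 h) //= scale_diracE eqxx.
rewrite big1 ?addr0 // => g gh.
by rewrite scale_diracE eq_sym (negbTE gh).
Qed.

Lemma galois_map_balanced : @balanced R (rrestr psi) (lrestr psi) _
  (fun s t : S => \sum_(g : gT) (s * act g t) *: dirac S g).
Proof.
have D := ring_actD ha; have M h := (ring_act_monoid ha h).2.
split=> /= [s1 s2 u|u t1 t2|u r v].
- by rewrite -big_split; apply: eq_bigr => g _; rewrite mulrDl scalerDl.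
- by rewrite -big_split; apply: eq_bigr => g _; rewrite D mulrDr scalerDl.
- by apply: eq_bigr => g _; rewrite rrestrE lrestrE M fa mulrA.
Qed.

Lemma galois_mapD : {morph galois_map psi act : x y / x + y}.
Proof. exact: tliftD galois_map_balanced. Qed.

Lemma galois_map_ptens s t h :
  galois_map psi act (ptens psi psi s t) h = s * act h t.
Proof.
pose F : {ffun gT -> S^o} := [ffun h => s * act h t].
suff -> : galois_map psi act (ptens psi psi s t) = F by rewrite ffunE.
rewrite galois_mapE // -(dirac_sum F).
by apply: eq_bigr => g _; rewrite ffunE.
Qed.

Lemma galois_inv_add G :
  cancel (galois_map psi act) G -> cancel G (galois_map psi act) ->
  {morph G : F1 F2 / F1 + F2}.
Proof. by move=> GK KG F1 F2; apply: (can_inj GK); rewrite galois_mapD !KG. Qed.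

End GaloisMap.

Section GaloisMapScale.
Context (R : comPzRingType) (S : pzRingType) (psi : {rmorphism R -> S})
  (gT : finGroupType) (act : gT -> S -> S).
Hypotheses (c : centralizing psi) (ha : is_ring_action act)
  (fa : forall g r, act g (psi r) = psi r).

Lemma galois_mapZ (r : R) x :
  galois_map psi act ((r : R^c) *: x) = psi r *: galois_map psi act x.
Proof.
elim/ptens_ind: x => [s t|x y hx hy]; last first.
  by rewrite scalerDr !galois_mapD // hx hy scalerDr.
apply/ffunP => h; rewrite scale_pure ffunE [LHS]galois_map_ptens //.
by rewrite galois_map_ptens // rrestrE -(centralizingC c) -mulrA.
Qed.

Lemma galois_invZ G (r : R) F :
  cancel (galois_map psi act) G -> cancel G (galois_map psi act) ->
  G (psi r *: F) = (r : R^c) *: G F.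
Proof. by move=> GK KG; apply: (can_inj GK); rewrite galois_mapZ !KG. Qed.
End GaloisMapScale.

(** * The Galois map of a tensor product *)

Section TensAct.
Context (R : comPzRingType) (S S' : pzRingType) (psi : {rmorphism R -> S})
  (psi' : {rmorphism R -> S'}) (gT gT' : finGroupType)
  (act : gT -> S -> S) (act' : gT' -> S' -> S').
Hypotheses (c : centralizing psi) (c' : centralizing psi').
Hypotheses (ha : is_ring_action act) (ha' : is_ring_action act').
Hypotheses (fa : forall g r, act g (psi r) = psi r)
  (fa' : forall g r, act' g (psi' r) = psi' r).

Local Notation tact := (tens_act c c' act act').

Lemma tens_actD g : {morph tact g : x y / x + y}.
Proof.
have D := ring_actD ha; have D' := ring_actD ha'.
have M h := (ring_act_monoid ha h).2; have M' h := (ring_act_monoid ha' h).2.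
apply: (@tliftD R (rrestr psi) (lrestr psi')).
split=> /= [s1 s2 t|u t1 t2|u r t].
- by rewrite D ptensDl.
- by rewrite D' ptensDr.
- by rewrite rrestrE lrestrE M M' fa fa' ptensZ.
Qed.

Let tactE g s s' : tact g (ptens psi psi' s s') =
  ptens psi psi' (act g.1 s) (act' g.2 s').
Proof. by case: g => g g'; exact: tens_actE. Qed.

Lemma tens_act_ring_action : is_ring_action tact.
Proof.
have D := ring_actD ha; have D' := ring_actD ha'.
split=> [g|g|x|g h x].
- exact: morphD_zmod (tens_actD g).
- have [o m] := ring_act_monoid ha g.1; have [o' m'] := ring_act_monoid ha' g.2.
  split=> [|x y]; first by rewrite [LHS]tactE o o'.
  elim/ptens_ind: x => [s s'|x1 x2 h1 h2]; last first.
    by rewrite mulrDl !tens_actD h1 h2 mulrDl.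
  elim/ptens_ind: y => [t t'|y1 y2 h1 h2]; last first.
    by rewrite mulrDr !tens_actD h1 h2 mulrDr.
  by rewrite tens_ring_mulE !tactE tens_ring_mulE m m'.
- elim/ptens_ind: x => [s s'|x y hx hy]; last by rewrite tens_actD hx hy.
  by rewrite tactE (ring_act1 ha) (ring_act1 ha').
- elim/ptens_ind: x => [s s'|x y hx hy]; last by rewrite !tens_actD hx hy.
  by rewrite !tactE (ring_actM ha) (ring_actM ha').
Qed.

Lemma tens_act_fix g r : tact g (tens_unit c c' r) = tens_unit c c' r.
Proof. by rewrite [LHS]tactE fa (ring_act_monoid ha' g.2).1. Qed.

Local Notation T2 := (tens_unit c c' ⊗ tens_unit c c')%type.
Local Notation "s # s'" := (ptens psi psi' s s') (at level 30).
Local Notation pT := (ptens (tens_unit c c') (tens_unit c c')).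

(** [mix] is bilinear and balanced over R ([mixZ]); it represents the
    isomorphism (S (x) S) (x) (S' (x) S') -> T (x) T that exchanges the two
    middle factors. [mix_inner] is its value at a (x) b in the first variable. *)
Definition mix_inner (a b : S) (x' : (psi' ⊗ psi')%type) : T2 :=
  @tlift R (rrestr psi') (lrestr psi') T2
    (fun a' b' : S' => pT (a # a') (b # b')) x'.

Lemma mix_inner_balanced a b : @balanced R (rrestr psi') (lrestr psi') T2
    (fun a' b' : S' => pT (a # a') (b # b')).
Proof.
split=> [a1 a2 b'|a' b1 b2|a' r b'].
- by rewrite ptensDr ptensDl.
- by rewrite ptensDr ptensDr.
rewrite rrestrE lrestrE -tens_unit_mulr -ptensZ -tens_unitC tens_unit_mulr.
by rewrite (centralizingC c').
Qed.

Lemma mix_innerE a b a' b' :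
  mix_inner a b (ptens psi' psi' a' b') = pT (a # a') (b # b').
Proof. exact: tlift_pure (mix_inner_balanced a b) a' b'. Qed.

Lemma mix_innerD a b : {morph mix_inner a b : x y / x + y}.
Proof. exact: tliftD (mix_inner_balanced a b). Qed.

Definition mix (x : (psi ⊗ psi)%type) (x' : (psi' ⊗ psi')%type) : T2 :=
  @tlift R (rrestr psi) (lrestr psi) T2 (fun a b : S => mix_inner a b x') x.

Lemma mix_balanced x' : @balanced R (rrestr psi) (lrestr psi) T2
    (fun a b : S => mix_inner a b x').
Proof.
elim/ptens_ind: x' => [a' b'|x y [h1 h2 h3] [k1 k2 k3]]; split=> *.
- by rewrite !mix_innerE !ptensDl.
- by rewrite !mix_innerE ptensDl ptensDr.
- rewrite !mix_innerE rrestrE lrestrE -(centralizingC c) -!(tens_unit_mul c c').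
  by rewrite tens_unitC ptensZ.
- by rewrite !mix_innerD h1 k1 addrACA.
- by rewrite !mix_innerD h2 k2 addrACA.
- by rewrite !mix_innerD h3 k3.
Qed.

Lemma mixE a b a' b' :
  mix (ptens psi psi a b) (ptens psi' psi' a' b') = pT (a # a') (b # b').
Proof. by rewrite -mix_innerE; exact: tlift_pure (mix_balanced _) a b. Qed.

Lemma mixDl x' : {morph mix^~ x' : x y / x + y}.
Proof. exact: tliftD (mix_balanced x'). Qed.

Lemma mixDr x : {morph mix x : x y / x + y}.
Proof.
move=> y z; elim/ptens_ind: x => [a b|x1 x2 h1 h2]; last first.
  by rewrite !mixDl h1 h2 addrACA.
rewrite /mix /ptens !(tlift_pure (mix_balanced _)); exact: mix_innerD.
Qed.

Lemma mixZ (r : R) x x' : mix ((r : R^c) *: x) x' = mix x ((r : R^c) *: x').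
Proof.
elim/ptens_ind: x => [a b|x y hx hy]; last by rewrite scalerDr !mixDl hx hy.
elim/ptens_ind: x' => [a' b'|x y hx hy]; last by rewrite scalerDr !mixDr hx hy.
rewrite !scale_pure [mix _ _]mixE [RHS]mixE !rrestrE.
by rewrite ptensZ (centralizingC c').
Qed.

Lemma galois_map_mix x x' g g' :
  galois_map (tens_unit c c') tact (mix x x') (g, g') =
  galois_map psi act x g # galois_map psi' act' x' g'.
Proof.
have GD := galois_mapD tens_act_ring_action tens_act_fix.
have G1D := galois_mapD ha fa; have G2D := galois_mapD ha' fa'.
elim/ptens_ind: x => [a b|x y hx hy]; last first.
  by rewrite mixDl GD G1D !ffunE hx hy ptensDl.
elim/ptens_ind: x' => [a' b'|x y hx hy]; last first.
  by rewrite mixDr GD G2D !ffunE hx hy ptensDr.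
rewrite mixE galois_map_ptens;
  [|exact: tens_act_ring_action|exact: tens_act_fix].
by rewrite !galois_map_ptens // tactE tens_ring_mulE.
Qed.

(** [galois_map_mix] and additivity of the inverses give
    x mix x' = sum_(g, g') G(x_g delta_g) mix G'(x'_g' delta_g'), where x_g and
    x'_g' are the coordinates of the images of x and x'. *)
Lemma galois_map_tens_bij :
  bijective (galois_map psi act) -> bijective (galois_map psi' act') ->
  bijective (galois_map (tens_unit c c') tact).
Proof.
move=> [G GK KG] [G' GK' KG'].
have GD := galois_inv_add ha fa GK KG.
have GD' := galois_inv_add ha' fa' GK' KG'.
have tD := galois_mapD tens_act_ring_action tens_act_fix.
(* On pure tensors, the inverse at the basis element delta_(g, g'). *)
pose b g s s' :=
  mix (G ((s : S) *: dirac S g.1)) (G' ((s' : S') *: dirac S' g.2)).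
have bB (g : gT * gT') : @balanced R (rrestr psi) (lrestr psi') T2 (b g).
  split=> [s1 s2 s'|s s1 s2|s r s']; rewrite /b.
  - by rewrite scalerDl GD mixDl.
  - by rewrite scalerDl GD' mixDr.
  - rewrite rrestrE lrestrE -(centralizingC c) -!scalerA.
    by rewrite (galois_invZ c ha fa _ _ GK KG)
         (galois_invZ c' ha' fa' _ _ GK' KG') mixZ.
pose L g : tens_ring c c' -> T2 := @tlift R (rrestr psi) (lrestr psi') T2 (b g).
have LD g : {morph L g : x y / x + y} by exact: tliftD (bB g).
have LE g s s' : L g (s # s') = b g s s' by exact: (tlift_pure (bB g) s s').
pose H (F : {ffun gT * gT' -> (tens_ring c c')^o}) := \sum_g L g (F g).
have HD : {morph H : x y / x + y}.
  by move=> x y; rewrite /H -big_split; apply: eq_bigr => g _; rewrite ffunE LD.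
exists H => [x|F].
  elim/(@ptens_ind R): x => [u v|x y hx hy]; last by rewrite tD HD hx hy.
  elim/ptens_ind: u => [a a'|u1 u2 h1 h2]; last by rewrite ptensDl tD HD h1 h2.
  elim/ptens_ind: v => [d d'|v1 v2 h1 h2]; last by rewrite ptensDr tD HD h1 h2.
  (* T (x) T is additively spanned by mixed pairs, so x = a (x) d and
     x' = a' (x) d' can be taken arbitrary in S (x) S and S' (x) S'. *)
  rewrite -mixE; move: (ptens psi psi a d) (ptens psi' psi' a' d') => x x'.
  rewrite /H; set y := galois_map psi act x; set y' := galois_map psi' act' x'.
  transitivity (\sum_g b g (y g.1) (y' g.2)).
    by apply: eq_bigr => -[g g'] _; rewrite galois_map_mix LE.
  rewrite -(pair_bigA _ (fun g g' => b (g, g') (y g) (y' g'))) /=.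
  rewrite /b /= -[in RHS](GK x) -/y -(dirac_sum y) (morphD_sum _ GD).
  rewrite (morphD_sum _ (mixDl x')); apply: eq_bigr => g _.
  by rewrite -(morphD_sum _ (mixDr _)) -(morphD_sum _ GD') !dirac_sum GK'.
rewrite /H (morphD_sum _ tD) -[RHS]dirac_sum; apply: eq_bigr => -[g g'] _.
move: (F _) => u; apply/ffunP=> -[h h']; rewrite scale_diracE.
elim/ptens_ind: u => [s s'|x y hx hy]; last first.
  by rewrite LD tD ffunE hx hy; case: eqP => _; rewrite ?addr0.
rewrite LE galois_map_mix KG KG' !scale_diracE xpair_eqE.
by case: eqP => _; case: eqP => _ //=;
   rewrite ?[ptens _ _ 0 _]pure0l // [LHS]pure0r.
Qed.

End TensAct.

(** * The structure map and injectivity *)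

Definition linear_pack (R : pzRingType) (U V : lmodType R) (f : U -> V)
    (fB : zmod_morphism f) (fZ : scalable f) : {linear U -> V} :=
  HB.pack f (GRing.isZmodMorphism.Build _ _ f fB)
    (GRing.isScalable.Build R _ _ _ f fZ).

Section StructureMap.
Context (R S S' : pzRingType) (psi : {rmorphism R -> S})
  (psi' : {rmorphism R -> S'}).

Local Notation R1 := (rrestr (idfun : {rmorphism R -> R})).

Fact rmorph_restr_scalable : scalable (psi : R1 -> rrestr psi).
Proof. by move=> r x; rewrite !rrestrE rmorphM. Qed.

(** R as a right module over itself is its restriction along the identity,
    which makes psi a map between two restrictions. *)
Definition rmorph_restr : {linear R1 -> rrestr psi} :=
  @linear_pack R^c R1 (rrestr psi) psi (rmorphB psi) rmorph_restr_scalable.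

(** This is R (x)_R S' = S'. *)
Lemma tensor_restr_pure1 (x : tensor R1 (lrestr psi')) :
  exists s', x = pure (1 : R1) (s' : lrestr psi').
Proof.
elim/tensor_ind: x => [r s'|x y [s ->] [t ->]]; last first.
  by exists (s + t); rewrite -pureDr.
exists (psi' r * s'); rewrite -[psi' r * s']lrestrE -pureZ rrestrE.
by rewrite mul1r.
Qed.

(** s' |-> 1 (x) s' is psi (x) S' precomposed with S' = R (x)_R S'; injectivity
    of psi survives tensoring with the flat S', and r (x) s' |-> psi'(r) s'
    recovers s' from 1 (x) s' in R (x)_R S'. *)
Lemma ptens1_inj : injective psi -> faithfully_flat (lrestr psi') ->
  injective (ptens psi psi' 1).
Proof.
move=> psiI ff s t E; apply/eqP; rewrite -subr_eq0; apply/eqP.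
have fB : @balanced R R1 (lrestr psi') S'
    (fun (r : R) (s' : S') => psi' r * s').
  split=> [r1 r2 u|r u v|r r' u]; first by rewrite rmorphD mulrDl.
    by rewrite mulrDr.
  by rewrite rrestrE lrestrE rmorphM mulrA.
have /(faithfully_flat_inj (f := rmorph_restr) ff psiI) x0 :
    tensor_map (lrestr psi') rmorph_restr
      (pure (1 : R1) (s - t : lrestr psi')) = 0.
  rewrite tensor_mapE /= rmorph1 (morphD_zmod (pureDr _)).
  by rewrite -/(ptens psi psi' 1 s) -/(ptens psi psi' 1 t) E subrr.
rewrite -[LHS]mul1r -(rmorph1 psi') -[LHS](tlift_pure fB) x0.
exact: morphD0 (tliftD fB).
Qed.
End StructureMap.

Lemma tens_unitE (R S S' : pzRingType) (psi : {rmorphism R -> S})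
    (psi' : {rmorphism R -> S'}) (c : centralizing psi) (c' : centralizing psi') r :
  tens_unit c c' r = ptens psi psi' 1 (psi' r).
Proof. by rewrite /tens_unit -[psi r]mul1r ptensZ mulr1. Qed.

Lemma centralizing_tens (R S S' : pzRingType) (psi : {rmorphism R -> S})
    (psi' : {rmorphism R -> S'}) (c : centralizing psi) (c' : centralizing psi') :
  faithfully_flat (lrestr psi') -> centralizing (tens_unit c c').
Proof.
move=> ff; split; last exact: tens_unitC.
move=> r t /=; rewrite !tens_unitE.
by move/(ptens1_inj (centralizing_inj c) ff)/(centralizing_inj c').
Qed.

(** * Descent: the invariants and the centre of a Galois extension *)

Section Invariants.
Context (R : comPzRingType) (S : pzRingType) (psi : {rmorphism R -> S}).
Hypothesis (c : centralizing psi).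

(** The first differential of the Amitsur complex R -> S -> S (x) S -> ... *)
Definition amitsur (s : rrestr psi) : (psi ⊗ psi)%type :=
  ptens psi psi 1 s - ptens psi psi s 1.

Fact amitsur_zmod : zmod_morphism amitsur.
Proof.
apply: morphD_zmod => s t; rewrite /amitsur ptensDr ptensDl opprD.
exact: addrACA.
Qed.

Fact amitsur_scalable : scalable amitsur.
Proof.
move=> r s; rewrite /amitsur scalerBr !scale_pure !rrestrE; congr (_ - _).
by rewrite [RHS]ptensZ (centralizingC c).
Qed.

Definition amitsur_lin : {linear rrestr psi -> _} :=
  linear_pack amitsur_zmod amitsur_scalable.

Definition tens_multiply (x : (psi ⊗ psi)%type) : S :=
  @tlift R (rrestr psi) (lrestr psi) S (fun s t : S => s * t) x.

Lemma tens_multiply_balanced :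
  @balanced R (rrestr psi) (lrestr psi) S (fun s t : S => s * t).
Proof.
split=> [s1 s2 t|s t1 t2|s r t]; [exact: mulrDl|exact: mulrDr|].
by rewrite rrestrE lrestrE mulrA.
Qed.

(** The map (a (x) b) (x) t |-> a (x) b t, a contracting homotopy of the Amitsur
    complex once it is tensored with S. *)
Definition amitsur_contract (x : tensor (psi ⊗ psi)%type (lrestr psi)) :
    (psi ⊗ psi)%type :=
  tlift (fun (x : (psi ⊗ psi)%type) (t : lrestr psi) =>
    (x : tens_ring c c) * (ptens psi psi 1 t : tens_ring c c) : (psi ⊗ psi)%type) x.

Lemma amitsur_contract_balanced :
  @balanced R (tensor (rrestr psi) (lrestr psi)) (lrestr psi) (psi ⊗ psi)%type
    (fun x t => (x : tens_ring c c) * (ptens psi psi 1 t : tens_ring c c)).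
Proof.
split=> [x1 x2 t|x t1 t2|x r t]; first exact: (tens_mulDl c c).
  by rewrite ptensDr; exact: (tens_mulDr c c).
by rewrite lrestrE -tens_unit_mulr mulrA -tens_unitC (tens_scaleE c c).
Qed.

(** The homotopy formula: every Amitsur cocycle x with coefficients in S equals
    1 (x) mu(x), where mu is the multiplication. *)
Lemma amitsur_contractE x :
  amitsur_contract (tensor_map (lrestr psi) amitsur_lin x) =
    ptens psi psi 1 (tens_multiply x) - x.
Proof.
have kD : {morph amitsur_contract : x y / x + y}.
  exact: tliftD amitsur_contract_balanced.
have mD : {morph tens_multiply : x y / x + y}.
  exact: tliftD tens_multiply_balanced.
elim/ptens_ind: x => [s t|x y hx hy].
  rewrite tensor_mapE [LHS](tlift_pure amitsur_contract_balanced) /=.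
  rewrite [tens_multiply _](tlift_pure tens_multiply_balanced).
  by rewrite [LHS]mulrBl !tens_ring_mulE !mul1r mulr1.
rewrite tensor_mapD kD mD ptensDr hx hy opprD.
exact: addrACA.
Qed.

(** Faithful flatness reflects exactness, and after tensoring with S the
    sequence is contractible. *)
Lemma amitsur_exact : faithfully_flat (lrestr psi) ->
  exact_at (rmorph_restr psi) amitsur_lin.
Proof.
move=> ff; apply/ff => x; split=> [x0|[u <-]].
  exists (pure (1 : rrestr (idfun : {rmorphism R -> R}))
    (tens_multiply x : lrestr psi)).
  rewrite tensor_mapE /= rmorph1.
  apply/eqP; rewrite -subr_eq0 -[X in X == _]amitsur_contractE x0.
  by apply/eqP; exact: morphD0 (tliftD amitsur_contract_balanced).
have [t ->] := tensor_restr_pure1 u; rewrite !tensor_mapE /= rmorph1.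
by rewrite /amitsur subrr pure0l.
Qed.

Context (gT : finGroupType) (act : gT -> S -> S).
Hypotheses (ha : is_ring_action act) (fa : forall g r, act g (psi r) = psi r)
  (ff : faithfully_flat (lrestr psi)) (GI : injective (galois_map psi act)).

(** For invariant s, the tensors 1 (x) s and s (x) 1 have the same image under
    the Galois map, so s is an Amitsur cocycle. *)
Lemma galois_invariant s : (forall g, act g s = s) -> exists r, psi r = s.
Proof.
move=> fs; apply/(amitsur_exact ff s).
apply/eqP; rewrite subr_eq0; apply/eqP/GI/ffunP => h.
by rewrite !galois_map_ptens // mul1r fs (ring_act_monoid ha h).1 mulr1.
Qed.

Lemma galois_trace s : exists r, psi r = \sum_g act g s.
Proof.
apply: galois_invariant => h; rewrite (morphD_sum _ (ring_actD ha h)).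
rewrite [RHS](reindex_inj (mulgI h)); apply: eq_bigr => g _.
by rewrite (ring_actM ha).
Qed.

(** For e = sum_i x_i (x) y_i, the map z |-> sum_i [z, x_i] (x) y_i. When e is
    the preimage of delta_1 the x_i generate S over R, and a single linear map
    tests commutation with all of them; taking values in S (x) S rather than in
    a power of S avoids choosing an expression of e. *)
Definition commutator_map (e : (psi ⊗ psi)%type) (z : rrestr psi) :
    (psi ⊗ psi)%type :=
  @tlift R (rrestr psi) (lrestr psi) _
    (fun x y : S => ptens psi psi (z * x - x * z) y) e.

Lemma commutator_map_balanced z : @balanced R (rrestr psi) (lrestr psi) _
    (fun x y : S => ptens psi psi (z * x - x * z) y).
Proof.
split=> [x1 x2 y|x y1 y2|x r y].
- by rewrite -ptensDl mulrDr mulrDl opprD addrACA.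
- by rewrite ptensDr.
- rewrite rrestrE lrestrE -ptensZ; congr ptens.
  by rewrite mulrBl -!mulrA (centralizingC c).
Qed.

Lemma commutator_map_ptens z x y :
  commutator_map (ptens psi psi x y) z = ptens psi psi (z * x - x * z) y.
Proof. exact: tlift_pure (commutator_map_balanced z) x y. Qed.

Lemma commutator_mapD z : {morph commutator_map^~ z : e f / e + f}.
Proof. exact: tliftD (commutator_map_balanced z). Qed.

Fact commutator_map_zmod e : zmod_morphism (commutator_map e).
Proof.
apply: morphD_zmod => z w; elim/ptens_ind: e => [x y|e f he hf].
  by rewrite !commutator_map_ptens -ptensDl mulrDr mulrDl opprD addrACA.
by rewrite !commutator_mapD he hf addrACA.
Qed.

Fact commutator_map_scalable e : scalable (commutator_map e).
Proof.
move=> r z; elim/ptens_ind: e => [x y|e f he hf]; last first.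
  by rewrite !commutator_mapD he hf scalerDr.
rewrite !commutator_map_ptens scale_pure !rrestrE; congr ptens.
by rewrite mulrBl -!mulrA (centralizingC c).
Qed.

Definition commutator_lin e : {linear rrestr psi -> _} :=
  linear_pack (commutator_map_zmod e) (commutator_map_scalable e).

(** The map x (x) y |-> x tr(y s), written through the Galois map. At the
    preimage of delta_1 it returns s. *)
Definition trace_pairing (s : S) (e : (psi ⊗ psi)%type) : S :=
  \sum_g galois_map psi act e g * act g s.

(** z x tr(y s) - x z tr(y s) = [z, x tr(y s)], since traces lie in R and so
    commute with z. *)
Lemma trace_pairing_commutator s e z :
  trace_pairing s (commutator_map e z) =
    z * trace_pairing s e - trace_pairing s e * z.
Proof.
have GD := galois_mapD ha fa.
have pD : {morph trace_pairing s : x y / x + y}.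
  move=> x y; rewrite -big_split; apply: eq_bigr => g _.
  by rewrite GD ffunE mulrDl.
have pE x y : trace_pairing s (ptens psi psi x y) = x * \sum_g act g (y * s).
  rewrite mulr_sumr; apply: eq_bigr => g _.
  by rewrite galois_map_ptens // (ring_act_monoid ha g).2 mulrA.
elim/ptens_ind: e => [x y|e f he hf]; last first.
  by rewrite commutator_mapD !pD he hf mulrDr mulrDl opprD addrACA.
rewrite commutator_map_ptens !pE; have [r <-] := galois_trace (y * s).
by rewrite mulrBl -!mulrA (centralizingC c).
Qed.

Lemma commutator_exact : central psi -> bijective (galois_map psi act) ->
  exists e, exact_at (rmorph_restr psi) (commutator_lin e).
Proof.
move=> cc [G GK KG]; exists (G (dirac S 1%g)) => z.
have trE s : trace_pairing s (G (dirac S 1%g)) = s.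
  rewrite /trace_pairing KG (bigD1 1%g) //= ffunE eqxx mul1r (ring_act1 ha).
  by rewrite big1 ?addr0 // => g /negbTE g1; rewrite ffunE g1 mul0r.
split=> [/= z0|[r <-]].
  apply/(central_range cc) => s; apply/eqP; rewrite -subr_eq0.
  rewrite -[in X in X == 0](trE s) -trace_pairing_commutator z0.
  rewrite /trace_pairing (morphD0 (galois_mapD ha fa)).
  by rewrite big1 // => g _; rewrite ffunE mul0r.
rewrite /=; elim/ptens_ind: (G _) => [x y|e f he hf].
  by rewrite commutator_map_ptens (centralizingC c) subrr [LHS]pure0l.
by rewrite commutator_mapD he hf addr0.
Qed.
End Invariants.

(** * The centre of a tensor product *)

Section Centre.
Context (R : comPzRingType) (S S' : pzRingType) (psi : {rmorphism R -> S})
  (psi' : {rmorphism R -> S'}).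
Hypotheses (c : centralizing psi) (c' : centralizing psi').

Fact ptens_left_zmod y :
  zmod_morphism (fun s : rrestr psi => ptens psi psi s y).
Proof. by apply: morphD_zmod => s t; exact: ptensDl. Qed.

Fact ptens_left_scalable y : scalable (fun s : rrestr psi => ptens psi psi s y).
Proof. by move=> r s; rewrite scale_pure. Qed.

Definition ptens_left y : {linear rrestr psi -> _} :=
  linear_pack (ptens_left_zmod y) (ptens_left_scalable y).

(** On e = x (x) y, the commutator map tensored with S' factors through the
    commutator with x (x) 1 taken in S (x) S'. *)
Lemma tensor_map_commutator_ptens x y (z : tens_ring c c') :
  tensor_map (lrestr psi') (commutator_lin c (ptens psi psi x y)) z =
  tensor_map (lrestr psi') (ptens_left y)
    (z * (ptens psi psi' x 1 : tens_ring c c') -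
     (ptens psi psi' x 1 : tens_ring c c') * z).
Proof.
elim/ptens_ind: z => [s s'|z w hz hw].
  rewrite tensor_mapE /= commutator_map_ptens //.
  rewrite !tens_ring_mulE mul1r mulr1.
  by rewrite -(morphD_zmod (fun u v => ptensDl psi psi' u v s')) tensor_mapE.
rewrite tensor_mapD hz hw -tensor_mapD; congr tensor_map.
suff KD (X u v : tens_ring c c') :
    (u + v) * X - X * (u + v) = u * X - X * u + (v * X - X * v).
  exact: esym (KD _ _ _).
by rewrite mulrDl mulrDr opprD addrACA.
Qed.

Lemma tensor_map_commutator e (z : tens_ring c c') :
  (forall t, z * t = t * z) ->
  tensor_map (lrestr psi') (commutator_lin c e) z = 0.
Proof.
move=> zC; elim/ptens_ind: e => [x y|e f he hf].
  rewrite tensor_map_commutator_ptens zC subrr.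
  exact: morphD0 (@tensor_mapD _ _ _ _ _).
suff tD w : tensor_map (lrestr psi') (commutator_lin c (e + f)) w =
    tensor_map (lrestr psi') (commutator_lin c e) w +
    tensor_map (lrestr psi') (commutator_lin c f) w.
  by rewrite tD he hf addr0.
elim/ptens_ind: w => [s s'|w1 w2 h1 h2].
  by rewrite !tensor_mapE /= commutator_mapD // pureDl.
by rewrite !tensor_mapD h1 h2 addrACA.
Qed.

(** A central z is in the kernel of the commutator map tensored with S', hence
    of the form 1 (x) s' by flatness; comparing z with 1 (x) t shows that s' is
    central. *)
Lemma central_tens (gT : finGroupType) (act : gT -> S -> S) :
  is_ring_action act -> (forall g r, act g (psi r) = psi r) ->
  faithfully_flat (lrestr psi) -> bijective (galois_map psi act) ->
  faithfully_flat (lrestr psi') ->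
  central psi -> central psi' -> central (tens_unit c c').
Proof.
move=> ha fa ff Gb ff' cc cc'; have [inj cC] := centralizing_tens c c' ff'.
split=> // z; split=> [zC|[r <-]]; last exact: cC.
have [e /ff' ex] := commutator_exact c ha fa ff (bij_inj Gb) cc Gb.
have [u] := (ex z).1 (tensor_map_commutator e zC).
have [s' ->] := tensor_restr_pure1 u; rewrite tensor_mapE /= rmorph1 => zE.
have /(central_range cc') [r rE] : forall t, s' * t = t * s'.
  move=> t; apply: (ptens1_inj (central_inj cc) ff').
  have := zC (ptens psi psi' 1 t); rewrite -zE.
  by rewrite !tens_ring_mulE mul1r.
by exists r; rewrite -zE -rE; exact: tens_unitE.
Qed.
End Centre.

Theorem theorem3p1 (k : comPzRingType) (R : comPzAlgType k) (S S' : pzAlgType k)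
    (psi : {pzalgmorphism R -> S}) (psi' : {pzalgmorphism R -> S'})
    (gT gT' : finGroupType) (act : gT -> S -> S) (act' : gT' -> S' -> S')
    (c : centralizing psi) (c' : centralizing psi') :
  galois_extension psi act -> galois_extension psi' act' ->
  galois_extension (R := R) (S := tens_ring c c') (tens_unit c c')
    (tens_act c c' act act') /\
  centralizing (tens_unit c c') /\
  (central psi -> central psi' -> central (tens_unit c c')).
Proof.
move=> [ha fa ff Gb] [ha' fa' ff' Gb']; split; last first.
  split; first exact: centralizing_tens.
  exact: central_tens ha fa ff Gb ff'.
split.
- exact: tens_act_ring_action.
- exact: tens_act_fix.
- exact: faithfully_flat_tens.
- exact: galois_map_tens_bij.
Qed.
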